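(* Let $X=(X,\rho)$ be a compact metric space, and let $T:X\to X$ be a $1$-Lipschitz map, i.e. $\rho(Tx,Ty)\le\rho(x,y)$ for all $x,y\in X$. Let $\mathcal{B}$ denote the Borel $\sigma$-algebra on $X$, and let $\mu$ be a $T$-invariant, ergodic Borel probability measure on $X$. Let $\mathcal{E}=\{E_d\}_{d\in\mathcal{D}}$ be a finite measurable partition of $X$ which generates $\mathcal{B}$, and for $x \in X$, $k\in\mathbb{N}$ let $C_k(x)$ be the element of $\bigvee_{i=0}^{k-1}T^{-i}\mathcal{E}$ containing $x$. Suppose further that $\operatorname{diam}(C_k(x))\to0$ as $k\to\infty$ for $\mu$-almost all $x\in X$. Then the set of $x\in X$ such that $$\frac1{\mu(C_k(x))}\int_{C_k(x)}\frac1k\sum_{i=0}^{k-1}T^i f\,\mathrm{d}\mu\;\xrightarrow{k\to\infty}\;\int f\,\mathrm{d}\mu\quad\text{for all } f\in C(X)$$ is of full $\mu$-measure.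
   Context: $T^i f$ denotes $f\circ T^i$. $C(X)$ is the space of complex-valued continuous functions on $X$. The partition $\mathcal{E}$ generates $\mathcal{B}$ (is a generator) if the sets $T^iE_d$ ($i\in\mathbb{Z}$, $d\in\mathcal{D}$) generate the $\sigma$-algebra $\mathcal{B}$; $T^{-i}E$ for $i\geq 0$ denotes the preimage under $T^i$. Explicitly, $C_k(x)=\bigcap_{i=0}^{k-1}T^{-i}E_{d_i(x)}$, where $d_i(x)\in\mathcal{D}$ is determined by $T^ix\in E_{d_i(x)}$. For $\mu$-almost every $x$ one has $\mu(C_k(x))>0$ for all $k$, so the quotients are defined for almost every $x$. *)

(* Defs.v *)
From HB Require Import structures.
From mathcomp Require Import all_boot all_order all_algebra.
From mathcomp Require Import complex.
From mathcomp Require Import all_classical all_reals all_analysis.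

Set Implicit Arguments.
Unset Strict Implicit.
Unset Printing Implicit Defensive.

Import Order.TTheory GRing.Theory Num.Theory.
Import numFieldNormedType.Exports.

Local Open Scope classical_set_scope.
Local Open Scope ring_scope.

(* Metric spaces carrying a sigma-algebra; that the sigma-algebra is the Borel
   one is the separate predicate [is_borel].  Measurable types are pointed,
   which excludes only the empty space, on which there is no probability. *)
#[short(type="measurableMetricType")]
HB.structure Definition MeasurableMetric (d : measure_display)
  (R : numDomainType) := { X of Measurable d X & Metric R X }.

Definition is_borel (d : measure_display) (R : numDomainType)
    (X : measurableMetricType d R) : Prop :=
  (measurable : set (set X)) = <<s (open : set (set X)) >>.

Definition nonexpansive (R : numDomainType) (X : metricType R) (T : X -> X) :
    Prop :=
  forall x y, mdist (T x) (T y) <= mdist x y.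

(* In \bar R the supremum needs no boundedness side condition; the value on
   the empty set is -oo. *)
Definition diam (R : realType) (X : metricType R) (A : set X) : \bar R :=
  ereal_sup [set (mdist y z)%:E | y in A & z in A].

Section dynamics.
Context (d : measure_display) (X : measurableType d) (R : realType).

Definition invariant_measure (mu : probability X R) (T : X -> X) : Prop :=
  forall A : set X, measurable A -> mu (T @^-1` A) = mu A.

Definition ergodic (mu : probability X R) (T : X -> X) : Prop :=
  forall A : set X, measurable A -> T @^-1` A = A ->
    mu A = 0%E \/ mu A = 1%E.

(* Cells may be empty. *)
Definition measurable_partition (D : finType) (E : D -> set X) : Prop :=
  [/\ forall i, measurable (E i),
      trivIset [set: D] E
    & \bigcup_i E i = [set: X]].

(* T^n A for n : int: the forward image for n >= 0 and the preimage under
   T^(-n) for n < 0; T is not assumed to be invertible. *)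
Definition iterz_set (T : X -> X) (n : int) (A : set X) : set X :=
  match n with
  | Posz m => iter m T @` A
  | Negz m => iter m.+1 T @^-1` A
  end.

Definition generator (T : X -> X) (D : finType) (E : D -> set X) : Prop :=
  <<s [set iterz_set T n (E i) | n in [set: int] & i in [set: D]] >>
    = (measurable : set (set X)).

End dynamics.

(* The union of the cells containing x; for a partition, the cell of x. *)
Definition cell (X : Type) (D : finType) (E : D -> set X) (x : X) : set X :=
  \bigcup_(i in [set i | E i x]) E i.

(* C_k(x) *)
Definition cylinder (X : Type) (T : X -> X) (D : finType) (E : D -> set X)
    (k : nat) (x : X) : set X :=
  \bigcap_(i in `I_k) iter i T @^-1` cell E (iter i T x).

Section complex_averages.
Context (d : measure_display) (X : measurableType d) (R : realType).

Definition cintegral (mu : probability X R) (A : set X) (f : X -> R[i]) :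
    R[i] :=
  Complex (\int[mu]_(x in A) complex.Re (f x))%R
          (\int[mu]_(x in A) complex.Im (f x))%R.

Definition birkhoff (T : X -> X) (f : X -> R[i]) (k : nat) (x : X) : R[i] :=
  k%:R^-1 * \sum_(i < k) f (iter i T x).

(* The inverse of 0 is 0 here, so a null set A gives the average 0.  A point x
   with some mu (C_k x) = 0 therefore has averages over C_k x that are
   eventually 0, which fails to converge to the integral of f = 1. *)
Definition set_average (mu : probability X R) (A : set X) (f : X -> R[i]) :
    R[i] :=
  (Complex (fine (mu A)) 0)^-1 * cintegral mu A f.

End complex_averages.

(* Main.v *)
(* Write A_k g for the k-th Birkhoff average of a continuous real g.  As T is
   nonexpansive, the A_k g are uniformly equicontinuous.  Let y be in the
   support of mu.  By ergodicity almost every orbit visits every ball around y,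
   and shifting an orbit segment changes A_k g by O(1/k), so
   A_k g(x) - A_k g(y) -> 0 for almost every x.  Integrating over x (dominated
   convergence, invariance of mu) gives A_k g(y) -> int g, with no ergodic
   theorem.  Equicontinuity and diam (C_k y) -> 0 then pass from A_k g(y) to its
   average over C_k y.  The exceptional set does not depend on g. *)
Require Import Defs.
From HB Require Import structures.
From mathcomp Require Import all_boot all_order all_algebra.
From mathcomp Require Import complex.
From mathcomp Require Import all_classical all_reals all_analysis.
From mathcomp Require Import measurable_realfun ring.
Import Order.TTheory GRing.Theory Num.Theory.
Import numFieldNormedType.Exports.
Local Open Scope classical_set_scope.
Local Open Scope ring_scope.

(** * Compactness and nonexpansive maps on metric spaces *)

Section metric_facts.
Context {R : realType} {X : metricType R}.

Lemma metric_ball_open (x : X) (r : R) : open (ball x r).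
Proof.
rewrite openE => y; rewrite ballEmdist /= => xyr.
apply/nbhs_ballP; exists (r - mdist x y) => /=; first by rewrite subr_gt0.
move=> z; rewrite ballEmdist /= => yz.
by rewrite (le_lt_trans (metric_triangle x y z))// -ltrBrDl.
Qed.

Lemma compact_continuous_bounded (g : X -> R) : compact [set: X] ->
  continuous g -> exists M : R, forall x, `|g x| <= M.
Proof.
move=> cX cg.
have : compact (range g).
  by apply: continuous_compact => //; exact: continuous_subspaceT.
(* [hM] gives a bound for each real strictly above [M], hence [M + 1]. *)
move=> /compact_bounded [M [_ hM]]; exists (M + 1) => x.
by apply: (hM (M + 1)); [rewrite ltrDl | exists x].
Qed.

Lemma compact_uniformly_continuous (g : X -> R) : compact [set: X] ->
  continuous g -> forall e : R, 0 < e ->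
  exists2 r : R, 0 < r & forall x y, mdist x y < r -> `|g x - g y| < e.
Proof.
move=> /compact_near_coveringP cX cg e e0.
pose P (r : R) (x : X) := forall y, mdist x y < r -> `|g x - g y| < e.
have [|r /= r0 hr] := cX R (0^'+) P _.
  move=> x0 _; have /cvgrPdist_lt/(_ (e / 2)) := cg x0.
  rewrite divr_gt0// => /(_ isT) /nbhs_ballP[s /= s0 hs].
  (* With [x] within [s / 2] of [x0] and [r < s / 2], both [x] and [y] lie within [s] of [x0], where
     [g] varies by less than [e / 2] from [g x0]. *)
  exists (ball x0 (s / 2), [set r : R | r < s / 2]) => /=.
    split; first by apply/nbhs_ballP; exists (s / 2) => //=; rewrite divr_gt0.
    by apply: nbhs_right_lt; rewrite divr_gt0.
  move=> [x r] /=; rewrite ballEmdist /= => -[x0x rs] y xy.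
  rewrite -(subrKA (g x0)) (le_lt_trans (ler_normD _ _))// [ltRHS]splitr.
  rewrite ltrD//.
    rewrite distrC hs// ballEmdist /= (lt_le_trans x0x)//.
    by rewrite ler_pdivrMr// ler_pMr// ler1n.
  rewrite hs// ballEmdist /= (le_lt_trans (metric_triangle x0 x y))//.
  by rewrite [ltRHS]splitr ltrD// (lt_trans xy).
(* [hr] covers the positive radii strictly below [r], hence the choice of [r / 2]. *)
exists (r / 2); first by rewrite divr_gt0.
move=> x y xy; apply: (hr (r / 2)) => //=; rewrite ?divr_gt0//.
by rewrite sub0r normrN gtr0_norm ?divr_gt0// ltr_pdivrMr// ltr_pMr// ltr1n.
Qed.

Lemma nonexpansive_iter (T : X -> X) (n : nat) :
  nonexpansive T -> nonexpansive (iter n T).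
Proof. by move=> hT; elim: n => [|n IH] x y //=; exact: le_trans (IH x y). Qed.

Lemma nonexpansive_continuous (T : X -> X) : nonexpansive T -> continuous T.
Proof.
move=> hT x; apply/cvg_ballP => e e0.
apply/nbhs_ballP; exists e => //= y; rewrite !ballEmdist /=.
exact: le_lt_trans.
Qed.

Lemma mdist_le_diam (A : set X) (x y : X) (r : R) : A x -> A y ->
  (diam A < r%:E)%E -> mdist x y < r.
Proof.
move=> Ax Ay; rewrite -lte_fin; apply: le_lt_trans.
by apply: ereal_sup_ubound; exists x => //; exists y.
Qed.

End metric_facts.

(** * Borel measurability and the support of a measure *)

Section borel_facts.
Context {R : realType} {d : measure_display} {X : measurableMetricType d R}.
Hypothesis borel : is_borel X.

Lemma borel_open_measurable (U : set X) : open U -> measurable U.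
Proof. by move=> oU; rewrite borel; apply: sub_sigma_algebra. Qed.

Lemma borel_ball_measurable (x : X) (r : R) : measurable (ball x r).
Proof. exact/borel_open_measurable/metric_ball_open. Qed.

Lemma borel_continuous_measurable (g : X -> R) :
  continuous g -> measurable_fun [set: X] g.
Proof.
move=> /continuousP cg; apply: (measurability _ (RGenOpens.measurableE R)).
move=> _ [_ [a [b ->] <-]]; rewrite setTI.
exact/borel_open_measurable/cg/interval_open.
Qed.

Lemma borel_continuous_self_measurable (T : X -> X) :
  continuous T -> measurable_fun [set: X] T.
Proof.
move=> /continuousP cT; apply: (measurability _ borel).
by move=> _ [U oU <-]; rewrite setTI; exact/borel_open_measurable/cT.
Qed.

Definition in_support (mu : probability X R) (x : X) : Prop :=
  forall r : R, 0 < r -> (0 < mu (ball x r))%E.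

(** A point outside the support has a null ball of radius [n.+1%:R^-1] for some [n]. For each [n],
    compactness covers such points by finitely many null balls; the union over [n] remains null. *)
Lemma ae_in_support (mu : probability X R) :
  compact [set: X] -> {ae mu, forall x, in_support mu x}.
Proof.
move=> cX.
have null_points (n : nat) :
    mu.-negligible [set x | mu (ball x n.+1%:R^-1) = 0%E].
  have n0 : (0 : R) < n.+1%:R^-1 by rewrite invr_gt0.
  have := cX; rewrite compact_cover.
  move=> /(_ X setT (fun z => ball z (n.+1%:R^-1 / 2))) [].
  - by move=> z _; exact: metric_ball_open.
  - by move=> z _; exists z => //; apply: ballxx; rewrite divr_gt0.
  move=> F _ covF.
  pose B z := ball z (n.+1%:R^-1 / 2) : set X.
  have : mu.-negligible
      (\big[setU/set0]_(z <- finmap.enum_fset F | mu (B z) == 0%E) B z).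
    elim/big_ind : _ => [||z /eqP z0]; first exact: negligible_set0.
      by move=> ? ?; exact: negligibleU.
    by apply/negligibleP => //; exact: borel_ball_measurable.
  apply: negligibleS.
  move=> x /= x0; have [z zF xz] := covF x I.
  (* The covering balls have half the radius, so one that contains [x] lies inside the null ball
     around [x]. *)
  have Bz0 : mu (B z) = 0%E.
    apply: (subset_measure0 _ _ _ x0).
    - exact: borel_ball_measurable.
    - exact: borel_ball_measurable.
    move=> y zy; rewrite [_^-1]splitr.
    exact: (ball_triangle (ball_sym xz) zy).
  rewrite -bigcup_seq_cond; exists z => //=.
  by rewrite Bz0 eqxx andbT.
have /ae_foralln : forall n, \forall x \ae mu, mu (ball x n.+1%:R^-1) <> 0%E.
  move=> n; rewrite /almost_everywhere /=.
  by apply: negligibleS (null_points n) => x /= /contrapT.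
apply: filterS => x hx r r0.
have [n nr] : exists n : nat, n.+1%:R^-1 < r.
  by have [|n] := @ltr_add_invr R 0 r; rewrite ?add0r// => ?; exists n.
rewrite lt_neqAle measure_ge0 andbT eq_sym; apply/eqP => mr0.
apply: (hx n); apply: (subset_measure0 _ _ _ mr0).
- exact: borel_ball_measurable.
- exact: borel_ball_measurable.
- exact: le_ball (ltW nr).
Qed.

End borel_facts.

(** The real counterpart of [birkhoff], giving its real and imaginary parts. Its value at [k = 0] is
    0, since the inverse of 0 is 0. *)
Definition birkhoffR {R : realType} {X : Type} (T : X -> X) (g : X -> R)
    (k : nat) (x : X) : R :=
  k%:R^-1 * \sum_(i < k) g (iter i T x).

(** * Invariance, recurrence and averages of bounded functions *)

Section measure_preserving.
Context {R : realType} {d : measure_display} {X : measurableType d}.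
Context {mu : probability X R} {T : X -> X}.
Hypothesis mT : measurable_fun [set: X] T.
Hypothesis invT : invariant_measure mu T.

Lemma measurable_iter (n : nat) : measurable_fun [set: X] (iter n T).
Proof.
by elim: n => [|n IH]; [exact: measurable_id | exact: (measurableT_comp mT IH)].
Qed.

(* The points visiting [B] infinitely often form a strictly invariant set, of
   the same measure as the points visiting [B] at least once. *)
Lemma ergodic_ae_visit (B : set X) : ergodic mu T -> measurable B ->
  (0 < mu B)%E -> \forall x \ae mu, exists n, B (iter n T x).
Proof.
move=> ergT mB B0.
pose U m := \bigcup_(n in [set n | (m <= n)%N]) iter n T @^-1` B.
have mU m : measurable (U m).
  apply: bigcup_measurable => n _.
  by rewrite -[X in measurable X]setTI; exact: measurable_iter.
have TU m : T @^-1` U m = U m.+1.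
  apply/seteqP; split => [x [n /= mn]|x [[|n] //= mn]].
    by rewrite /= -iterSr => ?; exists n.+1.
  by rewrite /= -/(iter n.+1 T x) iterSr => ?; exists n.
have muU m : mu (U m) = mu (U 0).
  by elim: m => // m <-; rewrite -TU invT.
have decU : nonincreasing_seq U.
  apply/nonincreasing_seqP => m; apply/subsetPset => x [n /= mn Bn].
  by exists n => //=; exact: ltnW.
pose A := \bigcap_m U m.
have mA : measurable A by exact: bigcap_measurable.
have TA : T @^-1` A = A.
  rewrite /A preimage_bigcap; under eq_bigcapr do rewrite TU.
  apply/seteqP; split => x Ux m _; last exact: Ux.
  by have /subsetPset := decU _ _ (leqnSn m); apply; exact: Ux.
have muA : mu A = mu (U 0).
  apply/esym/(@cvg_unique _ _ (mu \o U @ \oo)) => //.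
    by rewrite (_ : mu \o U = cst (mu (U 0)))//; [exact: cvg_cst|exact/funext].
  apply: nonincreasing_cvg_mu => //.
  by rewrite (le_lt_trans (probability_le1 _ _))// ltry.
have U0 : (0 < mu (U 0%N))%E.
  apply: (lt_le_trans B0); apply: le_measure; rewrite ?inE//.
  by move=> x Bx; exists 0%N.
have [A0|A1] := ergT A mA TA; first by rewrite -muA A0 ltxx in U0.
exists (~` U 0); split; first exact: measurableC.
  by rewrite probability_setC// -muA A1 subee.
by move=> x /= h [n _ Bn]; apply: h; exists n.
Qed.

Lemma bounded_measurable_integrable {g : X -> R} (M : R) {A : set X} :
  measurable A -> measurable_fun [set: X] g -> (forall x, `|g x| <= M) ->
  mu.-integrable A (EFin \o g).
Proof.
move=> mA mg gM; apply: measurable_bounded_integrable => //.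
- by rewrite (le_lt_trans (probability_le1 _ _))// ltry.
- exact: measurable_funS mg.
- exists M; split; first exact: num_real.
  by move=> N /ltW MN x _ /=; exact: le_trans (gM x) MN.
Qed.

(** Change of variables: the pushforward of [mu] under [T] agrees with [mu] on measurable sets. *)
Lemma Rintegral_invariant (g : X -> R) (M : R) :
  measurable_fun [set: X] g -> (forall x, `|g x| <= M) ->
  \int[mu]_x g (T x) = \int[mu]_x g x.
Proof.
move=> mg gM; rewrite /Rintegral; congr fine.
have <- : (\int[pushforward mu T]_x (g x)%:E = \int[mu]_x (g x)%:E)%E.
  by apply: eq_measure_integral => A mA _; exact: invT.
rewrite (integral_pushforward mT)//.
- exact/measurable_EFinP.
- rewrite preimage_setT; apply: (bounded_measurable_integrable M) => //.
  exact: (measurableT_comp mg mT).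
Qed.

Lemma measurable_birkhoffR (g : X -> R) (k : nat) :
  measurable_fun [set: X] g -> measurable_fun [set: X] (birkhoffR T g k).
Proof.
move=> mg; apply: measurable_funM => //; apply: measurable_sum => i.
exact: (measurableT_comp mg (measurable_iter i)).
Qed.

Lemma norm_sum_orbit_le (g : X -> R) (M : R) (k : nat) (x : X) :
  (forall i, (i < k)%N -> `|g (iter i T x)| <= M) ->
  `|\sum_(i < k) g (iter i T x)| <= M *+ k.
Proof.
move=> gM; rewrite (le_trans (ler_norm_sum _ _ _))//.
rewrite -[X in _ <= _ *+ X]card_ord -sumr_const.
by apply: ler_sum => i _; exact: gM.
Qed.

Lemma birkhoffR_le_bound (g : X -> R) (M : R) (k : nat) (x : X) :
  0 <= M -> (forall i, (i < k)%N -> `|g (iter i T x)| <= M) ->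
  `|birkhoffR T g k x| <= M.
Proof.
move=> M0 gM; rewrite /birkhoffR; case: k gM => [|k] gM.
  by rewrite invr0 mul0r normr0.
rewrite normrM gtr0_norm ?invr_gt0// ler_pdivrMl// mulr_natl.
exact: norm_sum_orbit_le.
Qed.

(* Telescoping: the two orbit segments differ in at most [2 n] terms. *)
Lemma birkhoffR_shift (g : X -> R) (M : R) (k n : nat) (x : X) :
  (forall x, `|g x| <= M) ->
  `|birkhoffR T g k (iter n T x) - birkhoffR T g k x| <=
    k%:R^-1 * (M *+ (n + n)).
Proof.
move=> gM; rewrite /birkhoffR -mulrBr normrM ger0_norm ?invr_ge0//.
apply: ler_wpM2l; rewrite ?invr_ge0//.
elim: n => [|n IH]; first by rewrite subrr normr0.
pose y := iter n T x.
have -> : \sum_(i < k) g (iter i T (iter n.+1 T x)) =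
    \sum_(i < k) g (iter i T y) + (g (iter k T y) - g y).
  elim: (k) => [|m IHm]; first by rewrite !big_ord0 subrr addr0.
  rewrite !big_ord_recr /= IHm -iterSr /=; ring.
rewrite addrAC addSn addnS !mulrSr -[leRHS]addrA.
rewrite (le_trans (ler_normD _ _))// lerD//.
by rewrite (le_trans (ler_normB _ _))// lerD.
Qed.

Lemma Rintegral_birkhoffR (g : X -> R) (M : R) (k : nat) : (0 < k)%N ->
  measurable_fun [set: X] g -> (forall x, `|g x| <= M) ->
  \int[mu]_x birkhoffR T g k x = \int[mu]_x g x.
Proof.
move=> k0 mg gM; rewrite /birkhoffR.
have mgi i : measurable_fun [set: X] (fun x => g (iter i T x)).
  exact: (measurableT_comp mg (measurable_iter i)).
have int_iter i : \int[mu]_x g (iter i T x) = \int[mu]_x g x.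
  (* The innermost [T] is peeled off, so that invariance applies to [g] composed with [iter i T]. *)
  elim: i => // i <-; under eq_Rintegral do rewrite -/(iter i.+1 T _) iterSr.
  by apply: (Rintegral_invariant (fun x => g (iter i T x)) M (mgi i)) => x.
have int_sum n : \int[mu]_x (\sum_(i < n) g (iter i T x)) =
    (\int[mu]_x g x) *+ n.
  elim: n => [|n IH].
    by under eq_Rintegral do rewrite big_ord0; rewrite Rintegral_cst// mul0r.
  under eq_Rintegral do rewrite big_ord_recr.
  rewrite RintegralD//= ?IH ?int_iter ?mulrSr//.
    apply: (bounded_measurable_integrable (M *+ n)) => //.
      exact: measurable_sum.
    by move=> x; exact: norm_sum_orbit_le.
  exact: (bounded_measurable_integrable M).
rewrite RintegralZl//; last first.
  apply: (bounded_measurable_integrable (M *+ k)) => //.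
    exact: measurable_sum.
  by move=> x; exact: norm_sum_orbit_le.
by rewrite int_sum -[X in _ * X]mulr_natl mulKf// pnatr_eq0 -lt0n.
Qed.

Lemma Rintegral_cst_probability (c : R) : \int[mu]_x (cst c x) = c.
Proof.
rewrite Rintegral_cst// -[RHS]mulr1; congr (_ * _).
exact: (congr1 fine (probability_setT mu)).
Qed.

(** The mean of [h] minus [c] is the mean of [h - c], whose integral over [C] is at most [e] times
    the mass of [C] in absolute value. *)
Lemma Rintegral_mean_close (h : X -> R) (M : R) (C : set X) (c e : R) :
  measurable C -> (0 < mu C)%E -> measurable_fun [set: X] h ->
  (forall x, `|h x| <= M) -> (forall x, C x -> `|h x - c| <= e) ->
  `|(fine (mu C))^-1 * (\int[mu]_(x in C) h x) - c| <= e.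
Proof.
move=> mC C0 mh hM hc.
have muC0 : 0 < fine (mu C).
  by rewrite fine_gt0// C0 (le_lt_trans (probability_le1 _ _))// ltry.
have mhc : measurable_fun [set: X] (fun x => h x - c).
  exact: measurable_funB.
have int_hc : mu.-integrable C (EFin \o (fun x => h x - c)).
  apply: (bounded_measurable_integrable (M + `|c|)) => // x.
  by rewrite (le_trans (ler_normB _ _))// lerD.
have -> : (fine (mu C))^-1 * (\int[mu]_(x in C) h x) - c =
    (fine (mu C))^-1 * \int[mu]_(x in C) (h x - c).
  rewrite RintegralB//; last 2 first.
  - exact: (bounded_measurable_integrable M).
  - exact: (bounded_measurable_integrable `|c|).
  by rewrite Rintegral_cst// mulrBr mulrCA mulVf ?mulr1// gt_eqF.
rewrite normrM gtr0_norm ?invr_gt0// ler_pdivrMl// mulrC.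
rewrite -Rintegral_cst// (le_trans (le_normr_Rintegral _ _))//.
apply: le_Rintegral => //; first exact: integrable_norm.
exact: (bounded_measurable_integrable `|e|).
Qed.

End measure_preserving.

(** * Cylinders of fixed length as a finite measurable family *)

Section cylinders.
Context {d : measure_display} {X : measurableType d} {R : realType}.
Context {T : X -> X} {D : finType} {E : D -> set X}.
Hypothesis mT : measurable_fun [set: X] T.
Hypothesis partE : measurable_partition E.

Lemma cylinder_refl (k : nat) (x : X) : cylinder T E k x x.
Proof.
have [_ _ cov] := partE; move=> i _ /=.
by have [j _ Ej] : (\bigcup_j E j) (iter i T x) by [rewrite cov]; exists j.
Qed.

(* The letters are the sets of cells containing a point: [cell] is the union of
   all of them. *)
Definition word_cylinder (k : nat) (w : k.-tuple {set D}) : set X :=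
  \bigcap_(i in `I_k)
    iter i T @^-1` \bigcup_(j in [set` nth finset.set0 w i]) E j.

Lemma measurable_word_cylinder (k : nat) (w : k.-tuple {set D}) :
  measurable (word_cylinder k w).
Proof.
have [mE _ _] := partE; apply: fin_bigcap_measurable => // i _.
rewrite -[X in measurable X]setTI; apply: measurable_iter => //.
by apply: fin_bigcup_measurable => // j _; exact: mE.
Qed.

(** The word records, at each time [i < k], which cells contain [iter i T x]. There are finitely
    many words of length [k], which yields measurability and almost sure positivity of cylinders. *)
Lemma cylinder_word (k : nat) (x : X) :
  exists w : k.-tuple {set D}, cylinder T E k x = word_cylinder k w.
Proof.
exists [tuple of mkseq (fun i => [set j | `[< E j (iter i T x) >]]%SET) k].
apply: eq_bigcapr => i /= ik; rewrite nth_mkseq//; congr (_ @^-1` _).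
by apply: eq_bigcupl; split=> j /=; rewrite finset.inE asboolE.
Qed.

Lemma measurable_cylinder (k : nat) (x : X) : measurable (cylinder T E k x).
Proof.
by have [w ->] := cylinder_word k x; exact: measurable_word_cylinder.
Qed.

(** For each [k], a point whose cylinder is null lies in the union of the null word cylinders, which
    is a finite union. *)
Lemma ae_cylinder_gt0 (mu : probability X R) :
  \forall x \ae mu, forall k, (0 < mu (cylinder T E k x))%E.
Proof.
apply/ae_foralln => k.
have : mu.-negligible (\big[setU/set0]_(w | mu (word_cylinder k w) == 0%E)
    word_cylinder k w).
  elim/big_ind : _ => [||w /eqP w0]; first exact: negligible_set0.
    by move=> ? ?; exact: negligibleU.
  by apply/negligibleP => //; exact: measurable_word_cylinder.
apply: negligibleS.
move=> x /= /negP; rewrite -leNgt => C0.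
have C0' : mu (cylinder T E k x) = 0%E.
  by apply/eqP; rewrite eq_le C0 measure_ge0.
have [w Cw] := cylinder_word k x.
by rewrite (bigD1 w) -?Cw ?C0'//=; left; exact: cylinder_refl.
Qed.

End cylinders.

(** * Convergence of Birkhoff averages under a nonexpansive ergodic map *)

Section nonexpansive_ergodic.
Context {d : measure_display} {R : realType} {X : measurableMetricType d R}.
Context {T : X -> X} {mu : probability X R}.
Hypothesis compactX : compact [set: X].
Hypothesis borelX : is_borel X.
Hypothesis hT : nonexpansive T.
Hypothesis invT : invariant_measure mu T.
Hypothesis ergT : ergodic mu T.

Let mT : measurable_fun [set: X] T.
Proof.
exact/(borel_continuous_self_measurable borelX)/nonexpansive_continuous.
Qed.

(** Orbits that start within [r] of each other stay so at all times, hence a modulus of uniform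
    continuity for [g] serves every [k]. *)
Lemma birkhoffR_equicontinuous (g : X -> R) : continuous g ->
  forall e : R, 0 < e -> exists2 r : R, 0 < r & forall x y k, mdist x y < r ->
  `|birkhoffR T g k x - birkhoffR T g k y| <= e.
Proof.
move=> cg e e0.
have [r r0 gr] := compact_uniformly_continuous g compactX cg e e0.
exists r => // x y k xy; rewrite /birkhoffR -mulrBr -sumrB.
have [->|k0] := posnP k; first by rewrite invr0 mul0r normr0 ltW.
rewrite normrM gtr0_norm ?invr_gt0 ?ltr0n// ler_pdivrMl ?ltr0n// mulr_natl.
rewrite (le_trans (ler_norm_sum _ _ _))//.
rewrite -[X in _ <= _ *+ X]card_ord -sumr_const.
apply: ler_sum => i _; apply/ltW/gr.
exact: le_lt_trans (nonexpansive_iter T i hT x y) xy.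
Qed.

Lemma ae_birkhoffR_cvg0 (g : X -> R) (y : X) : continuous g ->
  in_support mu y ->
  \forall x \ae mu,
    birkhoffR T g k x - birkhoffR T g k y @[k --> \oo] --> (0 : R).
Proof.
move=> cg posy; have [M gM] := compact_continuous_bounded g compactX cg.
(* Countably many radii suffice, so a single null set handles all balls around [y]. *)
have : \forall x \ae mu, forall n, exists m, ball y n.+1%:R^-1 (iter m T x).
  apply/ae_foralln => n; apply: ergodic_ae_visit => //.
  - exact: borel_ball_measurable.
  - by apply: posy; rewrite invr_gt0.
apply: filterS => x vis; apply/cvgrPdist_le => e e0.
have e20 : 0 < e / 2 by rewrite divr_gt0.
have [r r0 gr] := birkhoffR_equicontinuous g cg _ e20.
have [n nr] : exists n : nat, n.+1%:R^-1 < r.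
  by have [|n] := @ltr_add_invr R 0 r; rewrite ?add0r// => ?; exists n.
have [m] := vis n; rewrite ballEmdist /= => /lt_trans/(_ nr) ym.
near=> k.
have k0 : (0 : R) < k%:R by near: k; exact: nbhs_infty_gtr.
(* The visiting point [iter m T x] is interposed. Equicontinuity compares it with [y]; the shift
   bound compares it with [x] and is at most [e / 2] once [k] reaches [M *+ (m + m) / (e / 2)]. *)
rewrite sub0r normrN -(subrKA (birkhoffR T g k (iter m T x))).
rewrite (le_trans (ler_normD _ _))// [leRHS]splitr lerD//; last first.
  by rewrite distrC gr.
rewrite distrC (le_trans (birkhoffR_shift g M k m x gM))//.
rewrite ler_pdivrMl// -ler_pdivrMr//.
by near: k; exact: nbhs_infty_ger.
Unshelve. all: by end_near. Qed.

(** The almost sure limit 0 of the differences is integrated over [x] with [y] fixed, so convergence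
    holds at every point of the support and not only almost everywhere. *)
Lemma birkhoffR_cvg (g : X -> R) (y : X) : continuous g ->
  in_support mu y ->
  birkhoffR T g k y @[k --> \oo] --> \int[mu]_x g x.
Proof.
move=> cg posy; have [M gM] := compact_continuous_bounded g compactX cg.
have M0 : 0 <= M := le_trans (normr_ge0 _) (gM y).
have mg := borel_continuous_measurable borelX g cg.
have bM k x : `|birkhoffR T g k x| <= M by exact: birkhoffR_le_bound.
have mb k := measurable_birkhoffR mT g k mg.
have [|||||_ _ +] := @dominated_convergence _ _ _ mu setT measurableT
  (fun k x => (birkhoffR T g k x - birkhoffR T g k y)%:E) (cst 0%E)
  (cst (M + M)%:E).
- by move=> k; apply/measurable_EFinP; exact: measurable_funB.
- exact: measurable_cst.
- apply: filterS (ae_birkhoffR_cvg0 g y cg posy) => x hx _.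
  by apply: cvg_EFin; [exact: nearW | exact: hx].
- exact: (bounded_measurable_integrable `|M + M|).
- apply: aeW => x k _; rewrite lee_fin.
  by rewrite (le_trans (ler_normB _ _))// lerD.
rewrite integral0 => /fine_cvg h.
(* By invariance the average integrates to the integral of [g], but only for [0 < k]; hence the
   restriction to large [k]. *)
have {}h : \int[mu]_x g x - birkhoffR T g k y @[k --> \oo] --> (0 : R).
  apply: cvg_trans h; apply: near_eq_cvg; near=> k => /=.
  have k0 : (0 < k)%N by near: k; exact: nbhs_infty_ge.
  rewrite -[fine _]/(\int[mu]_x (birkhoffR T g k x - birkhoffR T g k y)).
  rewrite RintegralB//; last 2 first.
  - exact: (bounded_measurable_integrable M).
  - exact: (bounded_measurable_integrable `|birkhoffR T g k y|).
  rewrite (Rintegral_birkhoffR mT invT g M)//.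
  by congr (_ - _); exact: Rintegral_cst_probability.
rewrite -[X in _ --> X]subr0.
rewrite (_ : (fun k => _) =
    (fun k => \int[mu]_x g x - (\int[mu]_x g x - birkhoffR T g k y))).
  by apply: cvgB h; exact: cvg_cst.
by apply/funext => k; rewrite subKr.
Unshelve. all: by end_near. Qed.

(** Once the diameter of [C k] is below the equicontinuity radius, the average is within [e / 2] of
    its value at [y] throughout [C k], and so is its mean. Convergence at [y] supplies the other
    half. *)
Lemma mean_birkhoffR_cvg (g : X -> R) (C : nat -> set X) (y : X) :
  continuous g -> in_support mu y ->
  (forall k, measurable (C k)) -> (forall k, C k y) ->
  (forall k, (0 < mu (C k))%E) -> diam (C k) @[k --> \oo] --> 0%E ->
  (fine (mu (C k)))^-1 * (\int[mu]_(x in C k) birkhoffR T g k x)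
    @[k --> \oo] --> \int[mu]_x g x.
Proof.
move=> cg posy mC Cy muC dC; apply/cvgrPdist_le => e e0.
have [M gM] := compact_continuous_bounded g compactX cg.
have M0 : 0 <= M := le_trans (normr_ge0 _) (gM y).
have mg := borel_continuous_measurable borelX g cg.
have e20 : 0 < e / 2 by rewrite divr_gt0.
have [r r0 gr] := birkhoffR_equicontinuous g cg _ e20.
have /cvgrPdist_le/(_ _ e20) cvgy := birkhoffR_cvg g y cg posy.
have smallC : \forall k \near \oo, (diam (C k) < r%:E)%E.
  apply: (dC [set z | (z < r%:E)%E]); apply: open_nbhs_nbhs; split => //=.
  exact: open_ereal_lt_ereal.
near=> k.
rewrite -(subrKA (birkhoffR T g k y)) (le_trans (ler_normD _ _))//.
rewrite [leRHS]splitr lerD//; first by near: k.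
rewrite distrC; apply: (Rintegral_mean_close _ M) => //.
- exact: measurable_birkhoffR.
- by move=> x; exact: birkhoffR_le_bound.
move=> x Cx; apply: gr; apply: (mdist_le_diam (C k) _ _ _ Cx (Cy k)).
by near: k.
Unshelve. all: by end_near. Qed.

End nonexpansive_ergodic.

(** * Reduction of complex limits and averages to real ones *)

Section complex_facts.
Context {R : realType}.
Implicit Types z : R[i].

(** The bound for the real part, applied to [z] times the imaginary unit, which has the same
    norm. *)
Lemma normc_ge_Im z : `|complex.Im z|%:C%C <= `|z|.
Proof.
rewrite -normrN -ReiNIm (le_trans (normc_ge_Re _))//.
by rewrite normrM complexiE normCi mulr1.
Qed.

Lemma normc_le_ReIm z :
  `|z| <= (`|complex.Re z| + `|complex.Im z|)%:C%C.
Proof.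
rewrite [z in `|z|]complexE (le_trans (ler_normD _ _))// rmorphD /= lerD//.
  by rewrite normc_def /= expr0n addr0 sqrtr_sqr.
by rewrite normrM complexiE normCi mul1r normc_def /= expr0n addr0 sqrtr_sqr.
Qed.

Lemma complex_cvg {I : Type} {F : set_system I} {FF : Filter F}
    (f : I -> R[i]^o) (l : R[i]^o) :
  complex.Re (f x) @[x --> F] --> complex.Re l ->
  complex.Im (f x) @[x --> F] --> complex.Im l -> f x @[x --> F] --> l.
Proof.
move=> /cvgrPdist_lt reF /cvgrPdist_lt imF; apply/cvgrPdist_lt => e.
(* A positive element of [R[i]] has zero imaginary part, so the tolerance is a real [a], split
   evenly between the two coordinates. *)
case: e => a b; rewrite ltcE /= => /andP[/eqP -> a0].
have a20 : 0 < a / 2 by rewrite divr_gt0.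
near=> x.
rewrite (le_lt_trans (normc_le_ReIm _))// (_ : Complex a 0 = a%:C%C)// ltcR.
rewrite raddfB [complex.Im _]raddfB.
by rewrite [ltRHS]splitr ltrD//; near: x; [exact: reF|exact: imF].
Unshelve. all: by end_near. Qed.

Lemma continuous_Re {X : topologicalType} (f : X -> R[i]^o) :
  continuous f -> continuous (fun x => complex.Re (f x)).
Proof.
move=> cf x; apply/cvgrPdist_lt => e e0.
have /cvgrPdist_lt/(_ e%:C%C) := cf x; rewrite ltcR => /(_ e0).
apply: filterS => y fxy.
rewrite -ltcR (le_lt_trans _ fxy)// (le_trans _ (normc_ge_Re _))//.
by rewrite raddfB.
Qed.

Lemma continuous_Im {X : topologicalType} (f : X -> R[i]^o) :
  continuous f -> continuous (fun x => complex.Im (f x)).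
Proof.
move=> cf x; apply/cvgrPdist_lt => e e0.
have /cvgrPdist_lt/(_ e%:C%C) := cf x; rewrite ltcR => /(_ e0).
apply: filterS => y fxy.
rewrite -ltcR (le_lt_trans _ fxy)// (le_trans _ (normc_ge_Im _))//.
by rewrite raddfB.
Qed.

Lemma natV_mulc (k : nat) z :
  k%:R^-1 * z = Complex (k%:R^-1 * complex.Re z) (k%:R^-1 * complex.Im z).
Proof.
rewrite -(rmorph_nat (real_complex R)) -fmorphV /=.
by case: z => a b; simpc.
Qed.

Lemma Re_birkhoff {d} {X : measurableType d} (T : X -> X) (f : X -> R[i]) k x :
  complex.Re (birkhoff T f k x) = birkhoffR T (fun y => complex.Re (f y)) k x.
Proof. by rewrite /birkhoff natV_mulc /= raddf_sum. Qed.

Lemma Im_birkhoff {d} {X : measurableType d} (T : X -> X) (f : X -> R[i]) k x :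
  complex.Im (birkhoff T f k x) = birkhoffR T (fun y => complex.Im (f y)) k x.
Proof. by rewrite /birkhoff natV_mulc /= raddf_sum. Qed.

Lemma set_averageE {d} {X : measurableType d} (mu : probability X R)
    (A : set X) (f : X -> R[i]) :
  set_average mu A f =
  Complex ((fine (mu A))^-1 * \int[mu]_(x in A) complex.Re (f x))
          ((fine (mu A))^-1 * \int[mu]_(x in A) complex.Im (f x)).
Proof.
rewrite /set_average -[Complex _ 0]/((fine (mu A))%:C%C) -fmorphV /= /cintegral.
by simpc.
Qed.

End complex_facts.

Theorem theorem2p1 (R : realType) (d : measure_display)
    (X : measurableMetricType d R) (T : X -> X) (mu : probability X R)
    (D : finType) (E : D -> set X)
    (hcompact : compact [set: X])
    (hborel : is_borel X)
    (hT : nonexpansive T)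
    (hinv : invariant_measure mu T)
    (herg : ergodic mu T)
    (hpart : measurable_partition E)
    (hgen : generator T E)
    (hdiam : {ae mu, forall x, diam (cylinder T E k x) @[k --> \oo] --> 0%E}) :
  {ae mu, forall x, forall f : X -> R[i]^o, continuous f ->
    (set_average mu (cylinder T E k x) (birkhoff T f k) : R[i]^o)
      @[k --> \oo] --> (cintegral mu [set: X] f : R[i]^o)}.
Proof.
have mT : measurable_fun [set: X] T.
  exact/(borel_continuous_self_measurable hborel)/nonexpansive_continuous.
(* Three almost sure conditions on [x]: it lies in the support, its cylinders have positive mass,
   and they shrink. None mentions [f], so one null set serves all [f]. *)
apply: filterS3 (ae_in_support hborel mu hcompact)
  (ae_cylinder_gt0 mT hpart mu) hdiam => x posx Cx0 diamx f cf.
have mean_cvg (g : X -> R) : continuous g ->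
    (fine (mu (cylinder T E k x)))^-1 *
      (\int[mu]_(y in cylinder T E k x) birkhoffR T g k y)
    @[k --> \oo] --> \int[mu]_y g y.
  move=> cg; apply: (mean_birkhoffR_cvg hcompact hborel hT hinv herg g
    (fun k => cylinder T E k x) x) => //.
  - by move=> k; exact: (measurable_cylinder mT hpart).
  - by move=> k; exact: (cylinder_refl hpart).
under eq_fun do rewrite set_averageE.
apply: complex_cvg => /=.
- under eq_fun do under eq_Rintegral do rewrite Re_birkhoff.
  exact/mean_cvg/continuous_Re.
- under eq_fun do under eq_Rintegral do rewrite Im_birkhoff.
  exact/mean_cvg/continuous_Im.
Qed.
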